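(* Let $\mathcal A:\mathbb R^{n_1\times n_2}\to\mathbb R^m$ be linear and suppose there is $\Delta>0$ such that $\|\mathbf H\|_*\ge\sqrt{m/\Delta}\,\|\mathbf H\|_F$ for all nonzero $\mathbf H\in\mathrm{Null}(\mathcal A)$. Let $\mathbf X^0\in\mathbb R^{n_1\times n_2}$ be arbitrary, $\alpha>\sigma_{r+1}(\mathbf X^0)$, $C_3:=\frac{\alpha+\sigma_1(\mathbf X^0)}{\alpha-\sigma_{r+1}(\mathbf X^0)}$, $C_4:=\frac{2\alpha}{\alpha-\sigma_{r+1}(\mathbf X^0)}$. If $m\ge4(1+C_3)^2r\Delta$, then the solution $\mathbf X^*$ of (N2) with $\mathbf b=\mathcal A(\mathbf X^0)$ satisfies $\|\mathbf X^*-\mathbf X^0\|_*\le4C_4\hat\sigma(\mathbf X^0)$, where $\hat\sigma(\mathbf X^0)=\sum_{i=r+1}^{\min\{n_1,n_2\}}\sigma_i(\mathbf X^0)$.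
   Context: Problem (N2) is $\min_{\mathbf X}\{\|\mathbf X\|_*+\frac{1}{2\alpha}\|\mathbf X\|_F^2:\ \mathcal A(\mathbf X)=\mathbf b\}$. $\sigma_i(\cdot)$ is the $i$-th largest singular value (zero if $i$ exceeds the rank); $\|\cdot\|_*$, $\|\cdot\|_F$ are nuclear and Frobenius norms. *)

(* Defs.v *)
From HB Require Import structures.
From mathcomp Require Import all_boot all_order all_algebra.
From Stdlib Require Import ClassicalEpsilon.
Set Implicit Arguments.
Unset Strict Implicit.
Unset Printing Implicit Defensive.
Import Order.TTheory GRing.Theory Num.Theory.
Local Open Scope ring_scope.

Definition orthogonalmx (R : rcfType) (n : nat) (U : 'M[R]_n) : Prop :=
  U *m U^T = 1%:M.

Definition rdiag_mx (R : rcfType) (n1 n2 : nat) (s : seq R) : 'M[R]_(n1, n2) :=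
  \matrix_(i < n1, j < n2) (if (i : nat) == j then s`_i else 0).

Definition is_singular_values (R : rcfType) (n1 n2 : nat)
    (X : 'M[R]_(n1, n2)) (s : seq R) : Prop :=
  [/\ size s = minn n1 n2, sorted (fun a b : R => b <= a) s, all (fun a => 0 <= a) s &
      exists (U : 'M[R]_n1) (V : 'M[R]_n2),
        [/\ orthogonalmx U, orthogonalmx V & X = U *m rdiag_mx n1 n2 s *m V^T]].

(* The list of singular values (chosen via an SVD; it is unique). *)
Definition svals (R : rcfType) (n1 n2 : nat) (X : 'M[R]_(n1, n2)) : seq R :=
  epsilon (inhabits [::]) (is_singular_values X).

(* sigma X i = i-th largest singular value, 1-based; zero if i = 0 or
   i > min(n1,n2). *)
Definition sigma (R : rcfType) (n1 n2 : nat) (X : 'M[R]_(n1, n2)) (i : nat) : R :=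
  if i is k.+1 then (svals X)`_k else 0.

Definition nucnorm (R : rcfType) (n1 n2 : nat) (X : 'M[R]_(n1, n2)) : R :=
  \sum_(1 <= i < (minn n1 n2).+1) sigma X i.

Definition frobnorm (R : rcfType) (n1 n2 : nat) (X : 'M[R]_(n1, n2)) : R :=
  Num.sqrt (\sum_(i < n1) \sum_(j < n2) X i j ^+ 2).

Definition sigma_hat (R : rcfType) (n1 n2 : nat) (r : nat) (X : 'M[R]_(n1, n2)) : R :=
  \sum_(r.+1 <= i < (minn n1 n2).+1) sigma X i.

Definition N2_obj (R : rcfType) (n1 n2 : nat) (alpha : R) (X : 'M[R]_(n1, n2)) : R :=
  nucnorm X + (2 * alpha)^-1 * frobnorm X ^+ 2.

Definition solves_N2 (R : rcfType) (n1 n2 m : nat)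
    (A : 'M[R]_(n1, n2) -> 'cV[R]_m) (b : 'cV[R]_m) (alpha : R)
    (X : 'M[R]_(n1, n2)) : Prop :=
  A X = b /\ forall Y : 'M[R]_(n1, n2), A Y = b -> N2_obj alpha X <= N2_obj alpha Y.

(* Main.v *)
Require Import Defs.
From HB Require Import structures.
From mathcomp Require Import all_boot all_order all_algebra.
From mathcomp Require Import fingroup perm ring lra zify complex.
From Stdlib Require Import ClassicalEpsilon.
Import Order.TTheory GRing.Theory Num.Theory.
Local Open Scope ring_scope.
Set Implicit Arguments.
Unset Strict Implicit.
Unset Printing Implicit Defensive.

(** Only the pairing [<W, X> <= |W|_op * |X|_*], with equality for a suitable
    partial isometry, is needed; no majorization of singular values.

    Write [X0 = U D V^T], [H = Xs - X0], [K = U^T H V], and let [K'] be the part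
    of [K] in rows and columns of index [>= r].  Testing [X0 + H] against
    [diag(1_r, W)], where [W] norms [K'], the optimality of [Xs] gives
    [(alpha - x_r) |K'|_* <= 2 alpha shat + (alpha + x_0) g] with
    [g = sqrt r |H|_F] and [x] the singular values of [X0] counted from 0.  The
    discarded entries of [K] form two blocks with [r] rows, resp. [r] columns,
    so [|H|_* <= |K'|_* + 2 g].  Finally [2 (1 + C3) g <= |H|_*] by the null space
    hypothesis, so that [|H|_* <= C4 shat + (C3 + 2) g], and [C3 >= 1] makes the
    last term at most [3/4 |H|_*]. *)

(** * The trace inner product *)

Definition inner (R : rcfType) n1 n2 (A B : 'M[R]_(n1, n2)) : R :=
  \tr (A *m B^T).

Section Inner.
Variables (R : rcfType) (n1 n2 : nat).
Implicit Types A B C : 'M[R]_(n1, n2).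

Lemma innerE A B : inner A B = \sum_i \sum_j A i j * B i j.
Proof.
by apply: eq_bigr => i _; rewrite mxE; apply: eq_bigr => j _; rewrite mxE.
Qed.

Lemma innerC A B : inner A B = inner B A.
Proof. by rewrite /inner -mxtrace_tr trmx_mul trmxK. Qed.

Lemma innerDl A B C : inner (A + B) C = inner A C + inner B C.
Proof. by rewrite /inner mulmxDl mxtraceD. Qed.

Lemma innerZl a A B : inner (a *: A) B = a * inner A B.
Proof. by rewrite /inner -scalemxAl mxtraceZ. Qed.

Lemma innerNl A B : inner (- A) B = - inner A B.
Proof. by rewrite -scaleN1r innerZl mulN1r. Qed.

Lemma innerDr A B C : inner A (B + C) = inner A B + inner A C.
Proof. by rewrite innerC innerDl !(innerC A). Qed.

Lemma innerZr a A B : inner A (a *: B) = a * inner A B.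
Proof. by rewrite innerC innerZl innerC. Qed.

Lemma inner0l A : inner 0 A = 0.
Proof. by rewrite -(scale0r A) innerZl mul0r. Qed.

Lemma inner0r A : inner A 0 = 0.
Proof. by rewrite innerC inner0l. Qed.

Lemma inner_ge0 A : 0 <= inner A A.
Proof.
by rewrite innerE; do 2!apply: sumr_ge0 => ? _; rewrite -expr2 sqr_ge0.
Qed.

Lemma inner_eq0 A : (inner A A == 0) = (A == 0).
Proof.
apply/idP/eqP => [|->]; last by rewrite inner0l.
have sq i j : 0 <= A i j * A i j by rewrite -expr2 sqr_ge0.
rewrite innerE psumr_eq0 => [/allP h|i _]; last by apply: sumr_ge0.
apply/matrixP => i j; have := h i; rewrite mem_index_enum => /(_ isT).
rewrite /= psumr_eq0 // => /allP /(_ j); rewrite mem_index_enum => /(_ isT).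
by rewrite /= -expr2 sqrf_eq0 mxE => /eqP.
Qed.

Lemma frobnormE A : frobnorm A = Num.sqrt (inner A A).
Proof.
by rewrite /frobnorm innerE; congr Num.sqrt.
Qed.

Lemma sqr_frobnorm A : frobnorm A ^+ 2 = inner A A.
Proof. by rewrite frobnormE sqr_sqrtr ?inner_ge0. Qed.

(** Cauchy-Schwarz, with the squared norm of [A] replaced by an upper bound [c]. Later [c] is [r] up
    to a factor, which produces the [sqrt r] in the estimates. *)
Lemma inner_le_frobnorm A B c :
  inner A A <= c -> inner A B <= Num.sqrt c * frobnorm B.
Proof.
move=> le_c; have c_ge0 := le_trans (inner_ge0 A) le_c.
have [->|B0] := eqVneq B 0.
  by rewrite inner0r mulr_ge0 ?sqrtr_ge0.
have BB : 0 < inner B B by rewrite lt_def inner_eq0 B0 inner_ge0.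
have disc : inner A B ^+ 2 <= inner A A * inner B B.
  (* This squared norm expands to [<B,B> * (<A,A> <B,B> - <A,B>^2)]. *)
  have := inner_ge0 (inner B B *: A + (- inner A B) *: B).
  rewrite innerDl !innerDr !innerZl !innerZr (innerC B A) => h.
  have {}h : 0 <= inner B B * (inner A A * inner B B - inner A B ^+ 2) by lra.
  by rewrite -subr_ge0 -(pmulr_rge0 _ BB).
rewrite frobnormE -sqrtrM // (le_trans (ler_norm _)) // -sqrtr_sqr.
by rewrite ler_sqrt ?mulr_ge0 ?inner_ge0 // (le_trans disc) // ler_wpM2r ?inner_ge0.
Qed.

End Inner.

Lemma inner_mulmx (R : rcfType) m1 n1 n2 m2 (L : 'M[R]_(m1, n1))
    (A : 'M_(n1, n2)) (K : 'M_(n2, m2)) (B : 'M_(m1, m2)) :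
  inner (L *m A *m K) B = inner A (L^T *m B *m K^T).
Proof.
rewrite /inner !trmx_mul !trmxK [in RHS]mulmxA -[in RHS]mulmxA.
by rewrite -!mulmxA mxtrace_mulC !mulmxA.
Qed.

Lemma mulmx_tr_rV (R : rcfType) n (u v : 'rV[R]_n) : u *m v^T = (inner u v)%:M.
Proof. by rewrite /inner trace_mx11 -mx11_scalar. Qed.

(** * Singular value decomposition *)

Section Orthogonal.
Variable R : rcfType.

Lemma orthogonalmx_tr n (U : 'M[R]_n) : orthogonalmx U -> orthogonalmx U^T.
Proof. by rewrite /orthogonalmx trmxK; exact: mulmx1C. Qed.

Lemma orthogonalmxM n (U V : 'M[R]_n) :
  orthogonalmx U -> orthogonalmx V -> orthogonalmx (U *m V).
Proof.
rewrite /orthogonalmx => hU hV.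
by rewrite trmx_mul mulmxA -(mulmxA U) hV mulmx1.
Qed.

Lemma orthogonalmx_block n1 n2 (U : 'M[R]_n1) (V : 'M[R]_n2) :
  orthogonalmx U -> orthogonalmx V -> orthogonalmx (block_mx U 0 0 V).
Proof.
rewrite /orthogonalmx => hU hV.
rewrite tr_block_mx mulmx_block !trmx0 !mulmx0 !mul0mx !addr0 add0r hU hV.
by rewrite -scalar_mx_block.
Qed.

Lemma orthogonalmx_perm n (s : {perm 'I_n}) : orthogonalmx (perm_mx s : 'M[R]_n).
Proof. by rewrite /orthogonalmx tr_perm_mx -perm_mxM fingroup.mulgV perm_mx1. Qed.

(* Householder reflection along [w := e_0 - u]. *)
Lemma unit_rV_extend n (u : 'rV[R]_n.+1) :
  inner u u = 1 -> exists2 U : 'M[R]_n.+1, orthogonalmx U & row 0 U = u.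
Proof.
move=> u1; pose e : 'rV[R]_n.+1 := row 0 1%:M.
have rowE (U : 'M[R]_n.+1) : row 0 U = e *m U by rewrite -row_mul mul1mx.
have e1 : inner e e = 1.
  rewrite innerE big_ord1 (bigD1 0) //= !mxE mulr1 big1 ?addr0 // => j j0.
  by rewrite !mxE eq_sym (negPf j0) mul0r.
have [eu|ue] := eqVneq e u.
  by exists 1%:M; [rewrite /orthogonalmx trmx1 mulmx1|rewrite rowE mulmx1].
have [w wE] : {w | w = e - u} by exists (e - u).
pose c := 2 / inner w w.
have ww0 : inner w w != 0 by rewrite inner_eq0 wE subr_eq0.
(* Holds because [e] and [u] both have norm 1. It makes [c * inner e w = 1], so the reflection sends
   [e] to [e - w = u]. *)
have wwE : inner w w = 2 * inner e w.
  by rewrite wE !innerDl !innerDr !innerNl !(innerC _ (- u)) !innerNl u1 e1 (innerC u e); ring.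
exists (1%:M - c *: (w^T *m w)); last first.
  rewrite rowE mulmxBr mulmx1 -scalemxAr mulmxA mulmx_tr_rV mul_scalar_mx scalerA.
  have -> : c * inner e w = 1 by rewrite /c wwE; field; move: ww0; rewrite wwE mulf_eq0 negb_or => /andP[].
  by rewrite scale1r wE subKr.
rewrite /orthogonalmx; have -> : (1%:M - c *: (w^T *m w))^T = 1%:M - c *: (w^T *m w).
  by rewrite linearB linearZ /= trmx_mul trmxK trmx1.
rewrite mulmxBl mul1mx mulmxBr mulmx1 -scalemxAl -scalemxAr.
rewrite -!mulmxA (mulmxA w) mulmx_tr_rV mul_scalar_mx -!scalemxAr !scalerA.
rewrite -scalerBl -addrA -opprD -scalerDl.
(* The reflection is an involution, since [c * inner w w = 2]. *)
have -> : c + (c - c * (c * inner w w)) = 0 by rewrite /c; field.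
by rewrite scale0r subr0.
Qed.

(* If [(a + ib) M = (l + im)(a + ib)] with [M] symmetric, comparing [aMb^T] with
   [bMa^T] gives [m (|a|^2 + |b|^2) = 0]; so [a] and [b] are real eigenvectors. *)
Lemma symmetric_eigenvector n (M : 'M[R]_n.+1) : M^T = M ->
  exists2 u : 'rV[R]_n.+1, u != 0 & exists l, u *m M = l *: u.
Proof.
move=> symM; pose C := R[i]%C; pose toC := real_complex R.
(* [R] is real closed, so [R[i]] is algebraically closed and [M] has an eigenvector [v = a + ib]
   there. *)
have [z /eigenvalueP [v vM v0]] := spectral.eigenvalue_closed (map_mx toC M : 'M[C]_n.+1) isT.
pose a := map_mx (@complex.Re R) v; pose b := map_mx (@complex.Im R) v.
pose l := complex.Re z; pose m := complex.Im z.
have ReM : a *m M = l *: a - m *: b.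
  apply/rowP => j; have /rowP/(_ j) := vM.
  rewrite !mxE => /(congr1 (@complex.Re R)).
  rewrite raddf_sum /= => h.
  transitivity (complex.Re (z * v 0 j)); last first.
    by case: (z) (v 0 j) @l @m => [? ?] [? ?].
  rewrite -h; apply: eq_bigr => k _; rewrite !mxE; case: (v 0 k) => x y /=.
  by rewrite mulr0 subr0.
have ImM : b *m M = l *: b + m *: a.
  apply/rowP => j; have /rowP/(_ j) := vM.
  rewrite !mxE => /(congr1 (@complex.Im R)).
  rewrite raddf_sum /= => h.
  transitivity (complex.Im (z * v 0 j)); last first.
    by rewrite /l /m; case: (z) (v 0 j) => [? ?] [? ?].
  rewrite -h; apply: eq_bigr => k _; rewrite !mxE; case: (v 0 k) => x y /=.
  by rewrite mulr0 add0r.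
have v_ab : (a == 0) && (b == 0) = false.
  apply/negbTE; apply: contra v0 => /andP[/eqP a0 /eqP b0].
  apply/eqP/rowP => j; move/rowP/(_ j): a0; move/rowP/(_ j): b0.
  by rewrite !mxE; case: (v 0 j) => x y /= -> ->.
have m0 : m = 0.
  have : inner (a *m M) b = inner (b *m M) a.
    by rewrite -[a]mul1mx inner_mulmx trmx1 !mul1mx symM innerC.
  rewrite ReM ImM !innerDl innerNl !innerZl (innerC b a) => h.
  have {}h : m * (inner a a + inner b b) = 0 by lra.
  apply/eqP; move/eqP: h; rewrite mulf_eq0 paddr_eq0 ?inner_ge0 // !inner_eq0.
  by rewrite v_ab orbF.
rewrite m0 !scale0r ?subr0 ?addr0 in ReM ImM.
have [a0|a0] := eqVneq a 0; last by exists a => //; exists l.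
by exists b; [move: v_ab; rewrite a0 eqxx /= => ->|exists l].
Qed.

Lemma unit_scale n (u : 'rV[R]_n) : u != 0 ->
  exists2 c : R, 0 < c & inner (c *: u) (c *: u) = 1.
Proof.
move=> u0; have uu : 0 < inner u u by rewrite lt_def inner_eq0 u0 inner_ge0.
exists (Num.sqrt (inner u u))^-1; first by rewrite invr_gt0 sqrtr_gt0.
rewrite innerZl innerZr mulrA -invfM -expr2 sqr_sqrtr ?ltW //.
by rewrite mulVf // gt_eqF.
Qed.

(** * Existence of one singular triple *)

Definition singular_triple n1 n2 (X : 'M[R]_(n1, n2))
    (s : R) (u : 'rV_n1) (v : 'rV_n2) :=
  [/\ 0 <= s, inner u u = 1, inner v v = 1, u *m X = s *: v & v *m X^T = s *: u].

(** Take a unit eigenvector [u] of [X X^T] and [s = |uX|]. If [s] is nonzero, [v = uX / s] works;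
    otherwise any unit [v] with [v X^T = 0] does. *)
Lemma singular_triple_ex_le n1 n2 (X : 'M[R]_(n1.+1, n2.+1)) : (n1 <= n2)%N ->
  exists s u v, singular_triple X s u v.
Proof.
move=> le_n; have sym : (X *m X^T)^T = X *m X^T by rewrite trmx_mul trmxK.
have [u0 u00 [l u0X]] := symmetric_eigenvector sym.
have [c c0 u1] := unit_scale u00.
have : (c *: u0) *m (X *m X^T) = l *: (c *: u0).
  by rewrite -scalemxAl u0X !scalerA mulrC.
move: (c *: u0) u1 => u u1 uX.
have lE : l = inner (u *m X) (u *m X).
  by rewrite -{1}[u]mul1mx inner_mulmx trmx1 mul1mx -mulmxA uX innerZr u1 mulr1.
have [uX0|uX0] := eqVneq (u *m X) 0; last first.
  pose s := Num.sqrt (inner (u *m X) (u *m X)).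
  have s0 : 0 < s by rewrite sqrtr_gt0 lt_def inner_eq0 uX0 inner_ge0.
  have ss : s * s = inner (u *m X) (u *m X).
    by rewrite -expr2 sqr_sqrtr ?inner_ge0.
  exists s, u, (s^-1 *: (u *m X)); split => //; first exact: ltW.
  - by rewrite innerZl innerZr -ss; field; rewrite gt_eqF.
  - by rewrite scalerA mulfV ?scale1r // gt_eqF.
  - rewrite -scalemxAl -mulmxA uX scalerA lE -ss.
    by congr (_ *: _); field; rewrite gt_eqF.
(* If no nonzero [v] were killed by [X^T], then [X] would have rank [n2.+1], hence full row rank as
   [n1 <= n2], against [u X = 0]. *)
have /rowV0Pn [v /sub_kermxP vX v0] : kermx X^T != 0.
  rewrite kermx_eq0; apply/negP => /eqP; rewrite mxrank_tr => rX.
  have : row_free X by rewrite /row_free eqn_leq rank_leq_row rX.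
  move=> /(mulmx_free_eq0 u); rewrite uX0 eqxx => /esym /eqP u_eq0.
  by move: u1; rewrite u_eq0 inner0l => /eqP; rewrite eq_sym oner_eq0.
have [d d0 v1] := unit_scale v0.
exists 0, u, (d *: v); split => //; first by rewrite uX0 scale0r.
by rewrite -scalemxAl vX scaler0 scale0r.
Qed.

Lemma singular_triple_ex n1 n2 (X : 'M[R]_(n1.+1, n2.+1)) :
  exists s u v, singular_triple X s u v.
Proof.
have [/singular_triple_ex_le //|/ltnW le_n] := leqP n1 n2.
have [s [u [v [s0 u1 v1 uX vX]]]] := singular_triple_ex_le X^T le_n.
by exists s, v, u; split; rewrite // -[X]trmxK.
Qed.

(** * Deflation and sorting: the full decomposition *)

Lemma rdiag_mx_cons n1 n2 s (t : seq R) :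
  rdiag_mx (1 + n1) (1 + n2) (s :: t) =
  block_mx s%:M 0 0 (rdiag_mx n1 n2 t).
Proof.
apply/matrixP => i j; rewrite mxE.
case: (split_ordP i) => i' ->; case: (split_ordP j) => j' ->;
  rewrite ?block_mxEul ?block_mxEur ?block_mxEdl ?block_mxEdr !mxE ?ord1 //=.
Qed.

Lemma block_mx_rdiag n1 n2 s (t : seq R) (Y : 'M_(n1, n2)) U V :
  Y = U *m rdiag_mx n1 n2 t *m V^T ->
  block_mx s%:M 0 0 Y =
    block_mx 1%:M 0 0 U *m rdiag_mx (1 + n1) (1 + n2) (s :: t)
      *m (block_mx 1%:M 0 0 V)^T.
Proof.
move=> ->; rewrite rdiag_mx_cons tr_block_mx !mulmx_block !trmx0 trmx1.
by rewrite !mul0mx !mulmx0 !mul1mx !mulmx1 !addr0 !add0r mul0mx.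
Qed.

(** Induction by deflation: in orthonormal bases starting with [u] and [v], [X] has only [s] in its
    first row and column, and the remaining block is decomposed recursively. The triple is not
    chosen maximal, so the values come out in no particular order. *)
Lemma svd_unsorted n1 n2 (X : 'M[R]_(n1, n2)) :
  exists s, [/\ size s = minn n1 n2, all (fun a => 0 <= a) s &
    exists (U : 'M[R]_n1) (V : 'M[R]_n2),
      [/\ orthogonalmx U, orthogonalmx V & X = U *m rdiag_mx n1 n2 s *m V^T]].
Proof.
have o1 n : orthogonalmx (1%:M : 'M[R]_n) by rewrite /orthogonalmx trmx1 mulmx1.
elim: n1 n2 X => [|n1 IH] n2 X.
  exists [::]; split; rewrite ?min0n //; exists 1%:M, 1%:M; split => //.
  by rewrite [LHS]flatmx0 [RHS]flatmx0.
case: n2 X => [|n2] X.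
  exists [::]; split; rewrite ?minn0 //; exists 1%:M, 1%:M; split => //.
  by rewrite [LHS]thinmx0 [RHS]thinmx0.
have [s [u [v [s0 u1 v1 uX vX]]]] := singular_triple_ex X.
have [U oU Uu] := unit_rV_extend u1; have [V oV Vv] := unit_rV_extend v1.
have [Y defY] : {Y : 'M[R]_(1 + n1, 1 + n2) | Y = U *m X *m V^T} by exists (U *m X *m V^T).
(* The first row is [u X V^T = s v V^T], and [v] is the first row of the orthogonal [V]. *)
have row0Y : row 0 Y = s *: row 0 1%:M.
  by rewrite defY !row_mul Uu uX -scalemxAl -Vv -row_mul oV.
have col0Y : row 0 Y^T = s *: row 0 1%:M.
  by rewrite defY !trmx_mul trmxK !row_mul Vv mulmxA vX -scalemxAl -Uu -row_mul oU.
have Y0j j : Y 0 j = s * (0 == j)%:R by have /rowP/(_ j) := row0Y; rewrite !mxE.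
have Yi0 i : Y i 0 = s * (0 == i)%:R by have /rowP/(_ i) := col0Y; rewrite !mxE.
have l0 n : lshift n (0 : 'I_1) = 0 by apply/val_inj.
have YE : Y = block_mx s%:M 0 0 (drsubmx Y).
  rewrite -[LHS]submxK; congr block_mx; apply/matrixP => i j; rewrite !mxE ?ord1 ?l0.
  - by rewrite Y0j mulr1.
  - by rewrite Y0j mulr0.
  - by rewrite Yi0 mulr0.
have [t [st t0 [U' [V' [oU' oV' Y'E]]]]] := IH _ (drsubmx Y).
exists (s :: t); split; rewrite /= ?st ?minnSS ?s0 //.
exists (U^T *m (block_mx 1%:M 0 0 U' : 'M_(1 + n1))),
  (V^T *m (block_mx 1%:M 0 0 V' : 'M_(1 + n2))).
split; try by apply: orthogonalmxM; [exact: orthogonalmx_tr|exact: (@orthogonalmx_block 1)].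
have -> : X = U^T *m Y *m V.
  rewrite defY !mulmxA (mulmx1C oU) mul1mx -mulmxA.
  by rewrite (mulmx1C oV) mulmx1.
rewrite YE (block_mx_rdiag s Y'E) trmx_mul trmxK.
by rewrite !mulmxA.
Qed.

(** The same index permutation, applied to rows and to columns, moves the diagonal entries and keeps
    the off-diagonal zeros. *)
Lemma rdiag_mx_perm n1 n2 (s t : seq R) :
  size t = minn n1 n2 -> perm_eq s t ->
  exists (U : 'M[R]_n1) (V : 'M[R]_n2),
    [/\ orthogonalmx U, orthogonalmx V &
       rdiag_mx n1 n2 s = U *m rdiag_mx n1 n2 t *m V^T].
Proof.
move=> size_t /(perm_iotaP 0) [Is pIs sE].
(* The default [i] makes [f] the identity beyond the diagonal, so that one function induces a
   permutation of both ['I_n1] and ['I_n2]. *)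
pose f i := nth i Is i.
have sizeIs : size Is = size t by rewrite (perm_size pIs) size_iota.
have uIs : uniq Is by rewrite (perm_uniq pIs) iota_uniq.
have f_lt i : (i < size t)%N -> (f i < size t)%N.
  rewrite -sizeIs => lt_i; have := mem_nth i lt_i.
  by rewrite (perm_mem pIs) mem_iota sizeIs.
have f_id i : (size t <= i)%N -> f i = i.
  by rewrite -sizeIs => ?; rewrite /f nth_default.
have f_inj : injective f.
  move=> i j; have [lt_i|ge_i] := ltnP i (size t); have [lt_j|ge_j] := ltnP j (size t).
  - rewrite /f => h; apply/eqP; rewrite -(nth_uniq 0 _ _ uIs) ?sizeIs //.
    by rewrite (set_nth_default i) ?sizeIs // h (set_nth_default j) ?sizeIs.
  - by move=> h; have := f_lt _ lt_i; rewrite h f_id // ltnNge ge_j.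
  - by move=> h; have := f_lt _ lt_j; rewrite -h f_id // ltnNge ge_i.
  - by rewrite !f_id.
have g_ex n : (size t <= n)%N ->
    exists p : {perm 'I_n}, forall i, val (p i) = f i.
  move=> le_n; have f_ltn (i : 'I_n) : (f i < n)%N.
    by have [/f_lt/leq_trans->|/f_id->] := ltnP i (size t).
  have g_inj : injective (fun i : 'I_n => Ordinal (f_ltn i)).
    by move=> i j /(congr1 val) /f_inj /val_inj.
  by exists (perm g_inj) => i; rewrite permE.
have [p pE] : exists p : {perm 'I_n1}, forall i, val (p i) = f i.
  by apply: g_ex; rewrite size_t geq_minl.
have [q qE] : exists q : {perm 'I_n2}, forall i, val (q i) = f i.
  by apply: g_ex; rewrite size_t geq_minr.
exists (perm_mx p), (perm_mx q); split; try exact: orthogonalmx_perm.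
rewrite tr_perm_mx -row_permE -col_permE.
apply/matrixP => i j; rewrite !mxE /= pE qE (inj_eq f_inj) sE.
have [lt_i|ge_i] := ltnP i (size t).
  by rewrite (nth_map 0%N) ?sizeIs // /f (set_nth_default 0%N) ?sizeIs.
by rewrite nth_default ?size_map ?sizeIs // f_id // nth_default.
Qed.

(** Existence of a sorted decomposition is what gives the epsilon choice in [svals] its meaning. *)
Lemma svalsP n1 n2 (X : 'M[R]_(n1, n2)) : is_singular_values X (svals X).
Proof.
rewrite /svals; apply: epsilon_spec.
have [t [size_t t0 [U [V [oU oV XE]]]]] := svd_unsorted X.
pose s := sort (fun a b : R => b <= a) t.
have p : perm_eq t s by rewrite perm_sym perm_sort.
have size_s : size s = minn n1 n2 by rewrite -(perm_size p).
exists s; split => //.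
- by apply: sort_sorted => x y; apply: le_total.
- by rewrite -(perm_all _ p).
have [U' [V' [oU' oV' tE]]] := rdiag_mx_perm size_s p.
exists (U *m U'), (V *m V'); split; try exact: orthogonalmxM.
by rewrite XE tE trmx_mul !mulmxA.
Qed.

End Orthogonal.

(** * Duality between the spectral and nuclear norms *)

Section OperatorNorm.
Variable R : rcfType.

(** A function of the index makes truncated and shifted diagonals easy to write; [rdiag_mx n1 n2 s]
    is convertible to the case [f = nth 0 s]. *)
Definition fdiag n1 n2 (f : nat -> R) : 'M[R]_(n1, n2) :=
  \matrix_(i, j) (if i == j :> nat then f i else 0).

Lemma sum_fdiag n1 n2 (f : nat -> R) :
  \sum_(i < n1) \sum_(j < n2) (if i == j :> nat then f i else 0) =
  \sum_(0 <= k < minn n1 n2) f k.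
Proof.
transitivity (\sum_(0 <= i < n1 | (i < n2)%N) f i).
  rewrite [RHS]big_mkcond big_mkord; apply: eq_bigr => i _.
  rewrite -big_mkcond /=; case: ltnP => [lt_i|ge_i].
    by rewrite (big_pred1 (Ordinal lt_i)) // => j; rewrite eq_sym.
  by rewrite big1 // => j /eqP ij; have := ltn_ord j; rewrite -ij ltnNge ge_i.
rewrite (big_nat_widen 0 _ n1 xpredT) ?geq_minl //.
rewrite [LHS]big_nat_cond [RHS]big_nat_cond; apply: eq_bigl => i /=.
by rewrite leq_min; case: (i < n1)%N.
Qed.

Lemma sum_ltn_le n r : \sum_(i < n) (i < r)%:R <= r%:R :> R.
Proof.
have -> : \sum_(i < n) (i < r)%:R = (minn n r)%:R :> R.
  rewrite -natr_sum; congr (_%:R).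
  by elim: n => [|n IH]; rewrite ?big_ord0 ?min0n // big_ord_recr /= IH; lia.
by rewrite ler_nat geq_minr.
Qed.

Lemma inner_fdiagl n1 n2 f (A : 'M[R]_(n1, n2)) :
  inner (fdiag n1 n2 f) A =
  \sum_(i < n1) \sum_(j < n2) (if i == j :> nat then f i * A i j else 0).
Proof.
rewrite innerE; apply: eq_bigr => i _; apply: eq_bigr => j _.
by rewrite mxE; case: ifP => // _; rewrite mul0r.
Qed.

Lemma inner_fdiag n1 n2 f g :
  inner (fdiag n1 n2 f) (fdiag n1 n2 g) =
  \sum_(0 <= k < minn n1 n2) f k * g k.
Proof.
rewrite inner_fdiagl -sum_fdiag; apply: eq_bigr => i _; apply: eq_bigr => j _.
by rewrite mxE; case: eqP.
Qed.

Lemma bilinE n1 n2 (W : 'M[R]_(n1, n2)) (u : 'rV_n1) (v : 'rV_n2) :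
  inner (u *m W) v = \sum_i \sum_j u 0 i * W i j * v 0 j.
Proof.
rewrite innerE big_ord1 exchange_big; apply: eq_bigr => j _ /=.
by rewrite mxE mulr_suml.
Qed.

(* The spectral norm of [W] is at most [c]; the form linear in [W] avoids
   square roots and is symmetric under transposition. *)
Definition opnorm_le c n1 n2 (W : 'M[R]_(n1, n2)) : Prop :=
  forall (u : 'rV_n1) (v : 'rV_n2), 2 * inner (u *m W) v <= c * (inner u u + inner v v).

Lemma opnorm_leN c n1 n2 (W : 'M[R]_(n1, n2)) :
  opnorm_le c W -> opnorm_le c (- W).
Proof.
move=> hW u v; have := hW (- u) v.
by rewrite mulNmx mulmxN !innerNl (innerC u) innerNl opprK.
Qed.

Lemma opnorm_le_tr c n1 n2 (W : 'M[R]_(n1, n2)) :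
  opnorm_le c W -> opnorm_le c W^T.
Proof.
move=> hW u v; rewrite addrC; apply: le_trans (hW v u).
by rewrite -[u]mul1mx inner_mulmx trmx1 mul1mx trmxK mul1mx innerC.
Qed.

Lemma inner_orthogonal n (U : 'M[R]_n) (u : 'rV_n) :
  orthogonalmx U -> inner (u *m U) (u *m U) = inner u u.
Proof.
move=> oU; rewrite -{1}[u]mul1mx inner_mulmx trmx1 mul1mx -mulmxA.
by rewrite (oU : _ = _) mulmx1.
Qed.

Lemma opnorm_le_orthogonal c n1 n2 (W : 'M[R]_(n1, n2)) U V :
  orthogonalmx U -> orthogonalmx V ->
  opnorm_le c W -> opnorm_le c (U *m W *m V^T).
Proof.
move=> oU oV hW u v; rewrite !mulmxA.
have -> : inner (u *m U *m W *m V^T) v = inner (u *m U *m W) (v *m V).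
  by rewrite -{1}[u *m U *m W]mul1mx inner_mulmx trmx1 mul1mx trmxK.
by rewrite -(inner_orthogonal u oU) -(inner_orthogonal v oV).
Qed.

Lemma inner_delta n (i : 'I_n) (u : 'rV[R]_n) : inner u (delta_mx 0 i) = u 0 i.
Proof.
rewrite innerE big_ord1 (bigD1 i) //= mxE !eqxx mulr1 big1 ?addr0 // => j ji.
by rewrite mxE (negPf ji) andbF mulr0.
Qed.

Lemma opnorm_le_entry c n1 n2 (W : 'M[R]_(n1, n2)) i j :
  opnorm_le c W -> W i j <= c.
Proof.
move=> /(_ (delta_mx 0 i) (delta_mx 0 j)).
rewrite !inner_delta -rowE !mxE !eqxx /=; lra.
Qed.

(** Testing on a basis vector and the row itself gives [2 S <= 1 + S] for the squared norm [S] of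
    the row. *)
Lemma opnorm_le_row n1 n2 (W : 'M[R]_(n1, n2)) i :
  opnorm_le 1 W -> \sum_j W i j ^+ 2 <= 1.
Proof.
move=> /(_ (delta_mx 0 i) (row i W)).
rewrite inner_delta -rowE !mxE !eqxx /=.
have -> : inner (row i W) (row i W) = \sum_j W i j ^+ 2.
  by rewrite innerE big_ord1; apply: eq_bigr => j _; rewrite !mxE expr2.
lra.
Qed.

Lemma opnorm_le_col n1 n2 (W : 'M[R]_(n1, n2)) j :
  opnorm_le 1 W -> \sum_i W i j ^+ 2 <= 1.
Proof.
move=> /opnorm_le_tr /(opnorm_le_row j); apply: le_trans.
by apply: ler_sum => i _; rewrite mxE.
Qed.

Lemma opnorm_le_fdiag c n1 n2 f :
  (forall k, `|f k| <= c) -> opnorm_le c (fdiag n1 n2 f).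
Proof.
move=> hf u v; rewrite bilinE.
have c0 : 0 <= c by apply: le_trans (hf 0%N).
pose b i j : R := (i == j :> nat)%:R.
(* Each row index meets at most one column index on the diagonal, and conversely. *)
have sum_b n k : \sum_(j < n) b k j <= 1.
  rewrite /b; case: (ltnP k n) => [lt_k|ge_k].
    rewrite (bigD1 (Ordinal lt_k)) //= eqxx big1 ?addr0 // => j.
    by rewrite -val_eqE /= eq_sym => /negPf ->.
  rewrite big1 // => j _; rewrite (gtn_eqF (leq_trans (ltn_ord j) ge_k)) //.
have h : 2 * \sum_i \sum_j u 0 i * fdiag n1 n2 f i j * v 0 j <=
    \sum_(i < n1) \sum_(j < n2)
      (c * (u 0 i ^+ 2 * b i j) + c * (v 0 j ^+ 2 * b j i)).
  rewrite mulr_sumr; apply: ler_sum => i _; rewrite mulr_sumr.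
  apply: ler_sum => j _; rewrite mxE /b (eq_sym (j : nat)).
  case: eqP => _; last by rewrite !mulr0 mul0r mulr0 addr0.
  rewrite !mulr1 -mulrDr.
  (* With [u], [v] the two entries: [2 (c (u^2 + v^2) - 2 f u v) = (c - f) (u + v)^2 + (c + f) (u -
     v)^2]. *)
  have := hf i; rewrite ler_norml => /andP[f1 f2].
  have := sqr_ge0 (u 0 i + v 0 j); have := sqr_ge0 (u 0 i - v 0 j).
  have : 0 <= c - f i by lra.
  have : 0 <= c + f i by lra.
  nra.
apply: le_trans h _; under eq_bigr do rewrite big_split.
rewrite big_split mulrDr /= [X in _ + X]exchange_big /=.
have H n n' (w : 'rV[R]_n) :
    \sum_(i < n) \sum_(j < n') c * (w 0 i ^+ 2 * b i j) <= c * inner w w.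
  rewrite innerE big_ord1 mulr_sumr; apply: ler_sum => i _.
  rewrite -mulr_sumr ler_wpM2l // -mulr_sumr -expr2.
  by rewrite -[leRHS]mulr1 ler_wpM2l ?sqr_ge0.
exact: (lerD (H n1 n2 u) (H n2 n1 v)).
Qed.

Lemma inner_fdiag_le c n1 n2 (W : 'M[R]_(n1, n2)) f :
  opnorm_le c W -> (forall k, 0 <= f k) ->
  inner W (fdiag n1 n2 f) <= c * \sum_(0 <= k < minn n1 n2) f k.
Proof.
move=> hW f0; rewrite innerC inner_fdiagl -sum_fdiag mulr_sumr.
apply: ler_sum => i _; rewrite mulr_sumr; apply: ler_sum => j _.
case: ifP => _; last by rewrite mulr0.
by rewrite mulrC ler_wpM2r // opnorm_le_entry.
Qed.

Lemma svals_ge0 n1 n2 (X : 'M[R]_(n1, n2)) k : 0 <= (svals X)`_k.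
Proof.
have [_ _ /all_nthP s0 _] := svalsP X.
by case: (ltnP k (size (svals X))) => [/s0 //|/(nth_default 0) ->].
Qed.

Lemma svals_le n1 n2 (X : 'M[R]_(n1, n2)) i j :
  (i <= j)%N -> (svals X)`_j <= (svals X)`_i.
Proof.
move=> le_ij; have [_ ss _ _] := svalsP X.
case: (ltnP j (size (svals X))) => [lt_j|/(nth_default 0) ->]; last exact: svals_ge0.
apply: (sorted_leq_nth (leT := fun a b : R => b <= a)) => //.
- by move=> a b c h1 h2; apply: le_trans h1.
- by rewrite inE (leq_ltn_trans le_ij).
Qed.

Lemma nucnormE n1 n2 (X : 'M[R]_(n1, n2)) :
  nucnorm X = \sum_(0 <= k < minn n1 n2) (svals X)`_k.
Proof. by rewrite /nucnorm big_add1. Qed.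

Lemma sigma_hatE n1 n2 r (X : 'M[R]_(n1, n2)) :
  sigma_hat r X = \sum_(0 <= k < minn n1 n2) (if (r <= k)%N then (svals X)`_k else 0).
Proof.
rewrite /sigma_hat big_add1 -big_mkcond (big_nat_widenl r 0) //.
Qed.

(** The orthogonal factors of [X] move onto [W] without changing its bound, which leaves a pairing
    with a nonnegative diagonal. *)
Lemma inner_le_nucnorm c n1 n2 (W X : 'M[R]_(n1, n2)) :
  opnorm_le c W -> inner W X <= c * nucnorm X.
Proof.
have [_ _ _ [U [V [oU oV XE]]]] := svalsP X.
move=> hW; rewrite {1}XE innerC inner_mulmx innerC nucnormE.
apply: inner_fdiag_le; last exact: svals_ge0.
apply: opnorm_le_orthogonal => //; exact: orthogonalmx_tr.
Qed.

(** The witness replaces every singular value of [X] by 1. *)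
Lemma nucnorm_attained n1 n2 (X : 'M[R]_(n1, n2)) :
  exists2 W, opnorm_le 1 W & inner W X = nucnorm X.
Proof.
have [_ _ _ [U [V [oU oV XE]]]] := svalsP X.
exists (U *m fdiag n1 n2 (fun=> 1) *m V^T).
  apply: opnorm_le_orthogonal => //.
  by apply: opnorm_le_fdiag => k; rewrite normr1.
rewrite {1}XE inner_mulmx trmxK !mulmxA (mulmx1C oU) mul1mx.
rewrite -mulmxA (mulmx1C oV) mulmx1 nucnormE (inner_fdiag _ _ _ (nth 0 (svals X))).
by apply: eq_bigr => k _; rewrite mul1r.
Qed.

Lemma inner_orthogonal_conj n1 n2 (U : 'M[R]_n1) (V : 'M[R]_n2) X :
  orthogonalmx U -> orthogonalmx V ->
  inner (U *m X *m V^T) (U *m X *m V^T) = inner X X.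
Proof.
move=> oU oV; rewrite inner_mulmx trmxK !mulmxA (mulmx1C oU) mul1mx.
by rewrite -mulmxA (mulmx1C oV) mulmx1.
Qed.

(** * Truncation to the trailing corner and the error estimate *)

Definition corner r n1 n2 (X : 'M[R]_(n1, n2)) : 'M[R]_(n1, n2) :=
  \matrix_(i, j) (if (r <= i)%N && (r <= j)%N then X i j else 0).

Lemma inner_corner r n1 n2 (X Y : 'M[R]_(n1, n2)) :
  inner (corner r X) Y = inner X (corner r Y).
Proof.
rewrite !innerE; apply: eq_bigr => i _; apply: eq_bigr => j _; rewrite !mxE.
by case: ifP; rewrite ?mul0r ?mulr0.
Qed.

Lemma corner_id r n1 n2 (X : 'M[R]_(n1, n2)) : corner r (corner r X) = corner r X.
Proof. by apply/matrixP => i j; rewrite !mxE; case: andP. Qed.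

Lemma corner_fdiag r n1 n2 f :
  corner r (fdiag n1 n2 f) = fdiag n1 n2 (fun k => if (r <= k)%N then f k else 0).
Proof.
apply/matrixP => i j; rewrite !mxE; case: eqP => [->|_]; last by rewrite if_same.
by rewrite andbb.
Qed.

(** The two summands act on complementary coordinates, the first [r] and the rest, over which the
    squared norms of [u] and [v] split. *)
Lemma opnorm_le_corner r n1 n2 (W : 'M[R]_(n1, n2)) : opnorm_le 1 W ->
  opnorm_le 1 (fdiag n1 n2 (fun k => (k < r)%:R) + corner r W).
Proof.
move=> hW u v.
pose hd n (w : 'rV[R]_n) := \row_j (if (j < r)%N then w 0 j else 0).
pose tl n (w : 'rV[R]_n) := \row_j (if (r <= j)%N then w 0 j else 0).
have split_sq n (w : 'rV[R]_n) :
    inner w w = inner (hd n w) (hd n w) + inner (tl n w) (tl n w).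
  rewrite !innerE !big_ord1 -big_split; apply: eq_bigr => j _ /=; rewrite !mxE.
  by case: ltnP; rewrite mulr0 ?addr0 ?add0r.
have E1 : opnorm_le 1 (fdiag n1 n2 (fun=> 1)).
  by apply: opnorm_le_fdiag => k; rewrite normr1.
have e1 : inner (u *m fdiag n1 n2 (fun k => (k < r)%:R)) v
        = inner (hd _ u *m fdiag n1 n2 (fun=> 1)) (hd _ v).
  rewrite !bilinE; apply: eq_bigr => i _; apply: eq_bigr => j _; rewrite !mxE.
  case: eqP => [->|_]; last by rewrite !mulr0 !mul0r.
  by case: (j < r)%N; rewrite !(mulr0, mul0r, mulr1).
have e2 : inner (u *m corner r W) v = inner (tl _ u *m W) (tl _ v).
  rewrite !bilinE; apply: eq_bigr => i _; apply: eq_bigr => j _; rewrite !mxE.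
  by case: (leqP r i) => _; case: (leqP r j) => _ //=; rewrite !(mulr0, mul0r).
rewrite mulmxDr innerDl e1 e2 (split_sq _ u) (split_sq _ v).
have := E1 (hd _ u) (hd _ v); have := hW (tl _ u) (tl _ v); lra.
Qed.

(** Outside the corner, [W] consists of its first [r] rows and of its first [r] columns below them.
    Rows and columns of [W] have norm at most 1, so each piece has squared Frobenius norm at most
    [r]. *)
Lemma inner_le_corner r n1 n2 (W X : 'M[R]_(n1, n2)) : opnorm_le 1 W ->
  inner W X <= nucnorm (corner r X) + 2 * (Num.sqrt r%:R * frobnorm X).
Proof.
move=> hW.
pose A1 : 'M[R]_(n1, n2) := \matrix_(i, j) (if (i < r)%N then W i j else 0).
pose A2 : 'M[R]_(n1, n2) :=
  \matrix_(i, j) (if (r <= i)%N && (j < r)%N then W i j else 0).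
have -> : inner W X = inner W (corner r X) + inner A1 X + inner A2 X.
  rewrite !innerE -!big_split; apply: eq_bigr => i _ /=.
  rewrite -!big_split; apply: eq_bigr => j _ /=; rewrite !mxE.
  by case: (ltnP i r) => _; case: (ltnP j r) => _ /=;
    rewrite ?mul0r ?mulr0 ?addr0 ?add0r.
have n1r : inner A1 A1 <= r%:R.
  rewrite innerE; apply: le_trans (sum_ltn_le n1 r); apply: ler_sum => i _.
  under eq_bigr do rewrite mxE.
  case: ltnP => _; last by rewrite big1 // => j _; rewrite mul0r.
  exact: opnorm_le_row.
have n2r : inner A2 A2 <= r%:R.
  rewrite innerE exchange_big; apply: le_trans (sum_ltn_le n2 r).
  apply: ler_sum => j _ /=; under eq_bigr do rewrite mxE.
  case: (ltnP j r) => _; last by rewrite big1 // => i _; rewrite andbF mul0r.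
  apply: le_trans (opnorm_le_col j hW); apply: ler_sum => i _; rewrite andbT.
  by case: ifP => _; rewrite ?mul0r ?sqr_ge0 // expr2.
have := inner_le_frobnorm X n1r; have := inner_le_frobnorm X n2r.
have := inner_le_nucnorm (corner r X) hW; lra.
Qed.

(** [K] is [H] written in the singular bases of [X], where [X] becomes the diagonal [D]. *)
Lemma nucnorm_corner_le n1 n2 r alpha (X H : 'M[R]_(n1, n2)) : 0 < alpha ->
  nucnorm (X + H) + inner X H / alpha <= nucnorm X ->
  exists2 K : 'M_(n1, n2),
    nucnorm H <= nucnorm (corner r K) + 2 * (Num.sqrt r%:R * frobnorm H) &
  (alpha - sigma X r.+1) * nucnorm (corner r K) <=
    2 * alpha * sigma_hat r X + (alpha + sigma X 1) * (Num.sqrt r%:R * frobnorm H).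
Proof.
move=> a0 opt; rewrite /sigma.
have [_ _ _ [U [V [oU oV XE]]]] := svalsP X.
set x := nth 0 (svals X).
pose D := fdiag n1 n2 x; pose K := U^T *m H *m V.
have x0 k : 0 <= x k by exact: svals_ge0.
have xle i j : (i <= j)%N -> x j <= x i by exact: svals_le.
have XE' : X = U *m D *m V^T by [].
have conjK (Y : 'M[R]_(n1, n2)) : U^T *m (U *m Y *m V^T) *m V = Y.
  by rewrite !mulmxA (mulmx1C oU) mul1mx -mulmxA (mulmx1C oV) mulmx1.
have HE : H = U *m K *m V^T.
  by rewrite /K !mulmxA (oU : _ = _) mul1mx -mulmxA (oV : _ = _) mulmx1.
have oUt := orthogonalmx_tr oU; have oVt := orthogonalmx_tr oV.
have FE : frobnorm K = frobnorm H.
  by rewrite !frobnormE [in RHS]HE inner_orthogonal_conj.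
exists K.
  have [W hW <-] := nucnorm_attained H.
  rewrite [in leLHS]HE innerC inner_mulmx innerC -FE; apply: inner_le_corner.
  exact: opnorm_le_orthogonal.
have [W hW WE] := nucnorm_attained (corner r K).
pose E := fdiag n1 n2 (fun k => (k < r)%:R : R).
have W'X Y : inner (U *m (E + corner r W) *m V^T) (U *m Y *m V^T) =
    inner E Y + inner W (corner r Y).
  by rewrite inner_mulmx trmxK conjK innerDl inner_corner.
have test := inner_le_nucnorm (X + H)
  (opnorm_le_orthogonal oU oV (opnorm_le_corner r hW)).
rewrite innerDr {1}XE' {1}HE !W'X WE mul1r in test.
have ED : inner E D = \sum_(0 <= k < minn n1 n2) (if (k < r)%N then x k else 0).
  by rewrite inner_fdiag; apply: eq_bigr => k _; case: (k < r)%N; rewrite ?mul1r ?mul0r.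
have NX : nucnorm X = inner E D + sigma_hat r X.
  rewrite ED sigma_hatE nucnormE -big_split; apply: eq_bigr => k _ /=.
  by case: ltnP; rewrite ?addr0 ?add0r.
have WD : - inner W (corner r D) <= sigma_hat r X.
  rewrite -innerNl sigma_hatE corner_fdiag -[leRHS]mul1r.
  by apply: inner_fdiag_le => [|k]; [exact: opnorm_leN|case: ifP].
have XH : inner X H = inner D K.
  by rewrite {1}XE' {1}HE inner_mulmx trmxK conjK.
pose Dr := fdiag n1 n2 (fun k => if (k < r)%N then x k else 0).
have DE : D = Dr + corner r D.
  rewrite corner_fdiag; apply/matrixP => i j; rewrite !mxE.
  by case: eqP => _; rewrite ?addr0 //; case: ltnP; rewrite ?addr0 ?add0r.
(* Truncation is a self-adjoint projection, so only [corner r K] is seen; the diagonal entries from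
   index [r] on are at most [x r], which is [sigma X r.+1]. *)
have DK : - inner (corner r D) K <= x r * nucnorm (corner r K).
  rewrite -corner_id inner_corner -innerNl; apply: inner_le_nucnorm.
  apply: opnorm_leN; rewrite corner_fdiag; apply: opnorm_le_fdiag => k.
  by case: ifP => [/xle|_]; rewrite ?normr0 ?ger0_norm.
(* The leading diagonal of [K] enters with weight [alpha] from the test matrix and [x k] from
   [inner X H]. At most [r] weights are nonzero, each at most [alpha + x 0]. *)
pose c k := if (k < r)%N then alpha + x k else 0.
have cE : alpha * inner E K + inner Dr K = inner (fdiag n1 n2 c) K.
  rewrite -innerZl -innerDl; congr inner; apply/matrixP => i j; rewrite !mxE /c.
  by case: eqP => _; rewrite ?mulr0 ?addr0 //; case: ltnP; rewrite ?mulr0 ?addr0 ?mulr1.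
have cK : - inner (fdiag n1 n2 c) K <= (alpha + x 0%N) * (Num.sqrt r%:R * frobnorm H).
  rewrite -innerNl -FE mulrA -[alpha + x 0%N]ger0_norm ?addr_ge0 ?(ltW a0) //.
  rewrite -sqrtr_sqr -sqrtrM ?sqr_ge0 //; apply: inner_le_frobnorm.
  rewrite innerNl innerC innerNl opprK inner_fdiag.
  apply: (@le_trans _ _ (\sum_(k < minn n1 n2) (alpha + x 0%N) ^+ 2 * (k < r)%:R)).
    rewrite big_mkord; apply: ler_sum => k _; rewrite /c; case: ltnP => _.
      by rewrite mulr1 -expr2 lerXn2r ?nnegrE ?addr_ge0 ?(ltW a0) // lerD2l xle.
    by rewrite !mulr0.
  by rewrite -mulr_sumr ler_wpM2l ?sqr_ge0 ?sum_ltn_le.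
move: opt; rewrite XH NX -(ler_pM2l a0) mulrDr mulrCA divff ?gt_eqF // mulr1.
have DKE : inner D K = inner Dr K + inner (corner r D) K by rewrite {1}DE innerDl.
rewrite DKE => opt; rewrite -(ler_pM2l a0) in test; rewrite -(ler_pM2l a0) in WD.
(* The tail of [X] is counted once in [NX] and once in [WD], whence the factor 2; [DK] moves [x r]
   to the left-hand side. *)
lra.
Qed.

End OperatorNorm.

(** * Recovery bound from the null space condition *)

Theorem mainTheorem13 (R : rcfType) (n1 n2 m r : nat)
    (A : {linear 'M[R]_(n1, n2) -> 'cV[R]_m}) (Delta : R)
    (hDelta : 0 < Delta)
    (hnull : forall H : 'M[R]_(n1, n2), H != 0 -> A H = 0 ->
       nucnorm H >= Num.sqrt (m%:R / Delta) * frobnorm H)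
    (X0 : 'M[R]_(n1, n2)) (alpha : R)
    (halpha : alpha > sigma X0 r.+1) :
  let C3 := (alpha + sigma X0 1) / (alpha - sigma X0 r.+1) in
  let C4 := (2 * alpha) / (alpha - sigma X0 r.+1) in
  m%:R >= 4 * (1 + C3) ^+ 2 * r%:R * Delta ->
  forall Xs : 'M[R]_(n1, n2), solves_N2 A (A X0) alpha Xs ->
    nucnorm (Xs - X0) <= 4 * C4 * sigma_hat r X0.
Proof.
move=> C3 C4 hm Xs [AXs opt]; set H := Xs - X0.
have x1 : 0 <= sigma X0 1 by exact: svals_ge0.
have xr : 0 <= sigma X0 r.+1 by exact: svals_ge0.
have a0 : 0 < alpha := le_lt_trans xr halpha.
have d0 : 0 < alpha - sigma X0 r.+1 by rewrite subr_gt0.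
have C3_ge1 : 1 <= C3 by rewrite ler_pdivlMr //; lra.
have nullH : Num.sqrt (m%:R / Delta) * frobnorm H <= nucnorm H.
  have [->|H0] := eqVneq H 0; last by apply: hnull; rewrite // linearB /= AXs subrr.
  rewrite frobnormE inner0l sqrtr0 mulr0 nucnormE.
  by apply: sumr_ge0 => k _; apply: svals_ge0.
set g := Num.sqrt r%:R * frobnorm H.
(* The lower bound on [m] says exactly that [m / Delta] is at least the square of
   [2 (1 + C3) sqrt r]. *)
have g_le : 2 * (1 + C3) * g <= nucnorm H.
  apply: le_trans nullH; rewrite mulrA ler_wpM2r ?frobnormE ?sqrtr_ge0 //.
  have C30 : 0 <= 2 * (1 + C3) by lra.
  rewrite -[2 * (1 + C3)]ger0_norm // -sqrtr_sqr -sqrtrM ?sqr_ge0 //.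
  rewrite ler_sqrt ?divr_ge0 ?(ltW hDelta) // ler_pdivlMr //; lra.
have XsE : Xs = X0 + H by rewrite addrC subrK.
clearbody H.
(* [X0] is feasible, so optimality of [Xs] applies to it. Expanding the square at [X0 + H], the
   nonnegative term [inner H H / (2 alpha)] is dropped. *)
have descent : nucnorm (X0 + H) + inner X0 H / alpha <= nucnorm X0.
  have := opt X0 erefl; rewrite /N2_obj !sqr_frobnorm XsE.
  rewrite innerDl !innerDr (innerC H X0) => h.
  have := divr_ge0 (inner_ge0 H) (ltW a0).
  have e z : (2 * alpha)^-1 * z = z / alpha / 2 by field; rewrite gt_eqF.
  rewrite !e in h; lra.
have [K HK] := nucnorm_corner_le r a0 descent; rewrite -/g in HK *.
have C3E : (alpha + sigma X0 1) = C3 * (alpha - sigma X0 r.+1).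
  by rewrite divfK // gt_eqF.
have C4E : 2 * alpha = C4 * (alpha - sigma X0 r.+1).
  by rewrite divfK // gt_eqF.
rewrite C3E C4E => hK.
have {}hK : nucnorm (corner r K) <= C4 * sigma_hat r X0 + C3 * g.
  by rewrite -(ler_pM2l d0); lra.
have g0 : 0 <= g by rewrite mulr_ge0 // ?frobnormE sqrtr_ge0.
(* This gives [C3 + 2 <= 3/2 (1 + C3)] after multiplication by [g], so the [g] terms absorb three
   quarters of [nucnorm H]; the quarter left accounts for the factor 4. *)
have : 0 <= (C3 - 1) * g by rewrite mulr_ge0 // subr_ge0.
lra.
Qed.
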